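(* Let $(M,d)$ be a separable metric space and $(r_i)_{i\in\mathbb N}$ a dense sequence in $M$. The Cauchy representation of $M$ with respect to $(r_i)$ is complete if and only if $(M,d)$ is complete. Moreover, if $(M,d,(r_i))$ is a complete computable metric space, then its Cauchy representation is computably complete.
   Context: $\mathcal B=(\Sigma^* )^{\Sigma^*}$ is the Baire space of total functions on binary strings with the product topology; $\mathbb N$ is identified with binary strings. Cauchy representation $\xi_M$: $\varphi\in\mathcal B$ is a name of $x\in M$ iff for all $n\in\mathbb N$, $\varphi(n)\in\mathbb N$ and $d(x,r_{\varphi(n)})\le\frac1{n+1}$. A representation is complete if its domain is closed in $\mathcal B$, computably complete if its domain is co-r.e. closed (there is an oracle machine $M$ with $M^\varphi(\varepsilon)$ halting iff $\varphi\notin\mathrm{dom}\,\xi$). $(M,d,(r_i))$ is a computable metric space if the map $\mathbb N\times\mathbb N\to\mathbb R$, $(i,j)\mapsto d(r_i,r_j)$ is computable, where $n\in\mathbb N$ is named by the constant string function with value $n$, $\mathbb R$ is named by $\varphi$ with $\varphi(n)\in\mathbb Z$ and $|x-\varphi(n)/(n+1)|\le1/(n+1)$, and computability means having a realizer computed by an oracle Turing machine. *)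

(* Defs.v *)
From HB Require Import structures.
From mathcomp Require Import all_boot all_order all_algebra.
From mathcomp Require Import all_classical all_reals all_analysis.

Set Implicit Arguments.
Unset Strict Implicit.
Unset Printing Implicit Defensive.

Import Order.TTheory GRing.Theory Num.Theory.

Local Open Scope classical_set_scope.
Local Open Scope ring_scope.

Definition bitstring := seq bool.

Definition baire := {ptws bitstring -> discrete_topology bitstring}.

(* The identification of [bitstring] with [nat]: rank in length-lexicographic
   order; equivalently, the binary expansion of [(nat_of_str w).+1] is [1w]. *)
Definition nat_of_str : bitstring -> nat :=
  foldl (fun n (b : bool) => (n.*2 + b).+1) 0%N.

Lemma nat_of_str_bij : bijective nat_of_str.
Proof.
have rconsE w b : nat_of_str (rcons w b) = ((nat_of_str w).*2 + b).+1.
  by rewrite /nat_of_str -cats1 foldl_cat.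
have inj : injective nat_of_str.
  elim/last_ind => [|w b IH]; elim/last_ind => [|v c _] //; rewrite ?rconsE //.
  move=> /eqP; rewrite eqSS => /eqP e.
  have bc : b = c by move: (congr1 odd e); rewrite !oddD !odd_double !oddb.
  by move: e; rewrite bc => /addIn/double_inj/IH ->.
have surj n : exists w, nat_of_str w == n.
  have [m] := ubnP n; elim: m n => // m IH [|n] lenm; first by exists [::].
  have [|w /eqP wE] := IH n./2; first by rewrite -divn2 (leq_ltn_trans (leq_div _ _)).
  by exists (rcons w (odd n)); rewrite rconsE wE addnC odd_double_half.
exists (fun n => xchoose (surj n)) => [w|n]; last exact/eqP/(xchooseP (surj n)).
by apply: inj; apply/eqP/(xchooseP (surj _)).
Qed.

(* Sign bit followed by a natural; [Negz n] is [- n.+1], so that every integer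
   has exactly one code. *)
Definition int_of_str (w : bitstring) : option int :=
  if w is b :: v then
    Some (if b then Negz (nat_of_str v) else Posz (nat_of_str v))
  else None.

Definition cell := option bool. (* [None] is the blank *)

(* A two-way infinite tape, blank outside the listed cells: the cells to the
   left of the head, nearest first, and the cells from the head rightwards. *)
Record tape := Tape { tape_left : seq cell; tape_right : seq cell }.

Inductive direction := GoLeft | Stay | GoRight.

Definition scan (t : tape) : cell := head None (tape_right t).

Definition write (c : cell) (t : tape) : tape :=
  Tape (tape_left t) (c :: behead (tape_right t)).

Definition shift (m : direction) (t : tape) : tape :=
  match m with
  | GoLeft => Tape (behead (tape_left t)) (head None (tape_left t) :: tape_right t)
  | Stay => t
  | GoRight => Tape (scan t :: tape_left t) (behead (tape_right t))
  end.

Definition tape_of (w : bitstring) : tape := Tape [::] (map Some w).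

Fixpoint leading_bits (s : seq cell) : bitstring :=
  if s is Some b :: s' then b :: leading_bits s' else [::].

(* The word on a tape starts at the head and extends to the first blank. *)
Definition word (t : tape) : bitstring := leading_bits (tape_right t).

Inductive instruction (Q : finType) (n : nat) :=
| Halt
| Query of Q
| Step of ({ffun 'I_n -> cell} -> Q * {ffun 'I_n -> cell * direction}).
Arguments Halt {Q n}.
Arguments Query {Q n}.

(* Tape [ord0] carries the input and the output, tape [ord_max] is the oracle
   tape, and there are [om_work] further work tapes. *)
Record oracle_machine := OracleMachine {
  om_state : finType;
  om_work : nat;
  om_start : om_state;
  om_prog : om_state -> instruction om_state om_work.+2
}.

Section Run.
Variables (M : oracle_machine) (phi : bitstring -> bitstring).

Definition config := (om_state M * {ffun 'I_(om_work M).+2 -> tape})%type.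

Definition init (w : bitstring) : config :=
  (om_start M, [ffun i => tape_of (if i == ord0 then w else [::])]).

(* A query replaces the word [w] on the oracle tape by [phi w] in one step. *)
Definition step (c : config) : config :=
  match om_prog c.1 with
  | Halt => c
  | Query q =>
      (q, [ffun i => if i == ord_max then tape_of (phi (word (c.2 ord_max)))
                     else c.2 i])
  | Step delta =>
      let qa := delta [ffun i => scan (c.2 i)] in
      (qa.1, [ffun i => shift (qa.2 i).2 (write (qa.2 i).1 (c.2 i))])
  end.

Definition halted (c : config) : Prop := om_prog c.1 = Halt.

Definition halts (w : bitstring) : Prop :=
  exists t, halted (iter t step (init w)).

Definition outputs (w v : bitstring) : Prop :=
  exists t, let c := iter t step (init w) in
    halted c /\ word (c.2 ord0) = v.

End Run.

(* A representation is a partial map from [baire] onto [X], given by its graph: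
   [xi phi x] says that [phi] is a name of [x]. *)
Definition representation (X : Type) := baire -> X -> Prop.

Definition dom (X : Type) (xi : representation X) : set baire :=
  [set phi | exists x, xi phi x].

Definition complete_rep (X : Type) (xi : representation X) : Prop :=
  closed (dom xi).

Definition computably_complete_rep (X : Type) (xi : representation X) : Prop :=
  exists M : oracle_machine, forall phi : baire,
    halts M phi [::] <-> ~ dom xi phi.

(* Some machine computes a realizer: given any name of [x] as oracle, it halts
   on every input and the function it computes is a name of [f x]. *)
Definition computable (X Y : Type) (xi : representation X)
    (upsilon : representation Y) (f : X -> Y) : Prop :=
  exists M : oracle_machine, forall (phi : baire) (x : X), xi phi x ->
    exists psi : baire,
      (forall w, outputs M phi w (psi w)) /\ upsilon psi (f x).

Definition nat_rep : representation nat :=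
  fun phi n => forall w, nat_of_str (phi w) = n.

Definition real_rep (R : realType) : representation R :=
  fun phi x => forall w, exists2 z : int, int_of_str (phi w) = Some z &
    `|x - z%:~R / (nat_of_str w).+1%:R| <= (nat_of_str w).+1%:R^-1.

Definition baire_pair (phi psi : baire) : baire :=
  fun w => match w with
           | [::] => [::]
           | false :: v => phi v
           | true :: v => psi v
           end.

Definition prod_rep (X Y : Type) (xi : representation X)
    (upsilon : representation Y) : representation (X * Y) :=
  fun phi xy => exists phi1 phi2 : baire,
    [/\ phi = baire_pair phi1 phi2, xi phi1 xy.1 & upsilon phi2 xy.2].

Definition cauchy_rep (R : realType) (M : metricType R) (r : nat -> M) :
    representation M :=
  fun phi x => forall w,
    mdist x (r (nat_of_str (phi w))) <= (nat_of_str w).+1%:R^-1.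

(* The library's [completeType] is restricted to pointed types. *)
Definition complete_metric (R : realType) (M : metricType R) : Prop :=
  forall u : nat -> M, cauchy (u @ \oo) -> exists x : M, u @ \oo --> x.

Definition computable_metric (R : realType) (M : metricType R) (r : nat -> M) :
    Prop :=
  computable (prod_rep nat_rep nat_rep) (@real_rep R)
    (fun ij : nat * nat => mdist (r ij.1) (r ij.2)).

(* Main.v *)
Require Import Defs.
From HB Require Import structures.
From mathcomp Require Import all_boot all_order all_algebra.
From mathcomp Require Import all_classical all_reals all_analysis.
From mathcomp Require Import perm zify lra.

(* A name phi of a point is consistent: d(r_(phi v), r_(phi w)) <= 1/(v+1) + 1/(w+1)
   for all v and w. In a complete space every consistent phi is a name of
   lim r_(phi(0^t)), and consistency is a closed condition. Conversely, names of the
   terms of a Cauchy sequence can be chosen so that they converge in Baire space;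
   the limit then names the limit of the sequence.

   An inconsistency can be searched for mechanically. A trial is a string
   u = w 1 0^j. Put m = 0^(|u|+2) and k = w 0^(j+2), so that k+1 = 2^(j+2) (w+1) and
   2 (m+1) > k+1. Let K compute the distance, and run it on input k with an oracle that
   names the pair (phi w, phi m): the answer z approximates (k+1) d(r_(phi w), r_(phi m))
   up to 1. Accept if z >= 2^(j+2) + 3. Then d > 1/(w+1) + 1/(m+1), so phi is not
   consistent. If no u is accepted then d <= 1/(w+1) + 3/2^(j+2) for all w and j, so
   r_(phi(0^t)) converges to a point named by phi. The oracle always is a name, so each
   run of K halts, and the trials can be made one after the other. *)

Set Implicit Arguments.
Unset Strict Implicit.
Unset Printing Implicit Defensive.

Import Order.TTheory GRing.Theory Num.Theory.

Local Open Scope classical_set_scope.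
Local Open Scope ring_scope.

(** * Tapes and machines with arbitrary finite index types *)

(* Contents in absolute coordinates, and the position of the head: moving the head
   leaves the contents alone. *)
Definition atape := ((int -> cell) * int)%type.

Definition ablank : atape := (fun=> None, 0).

Definition ascan (t : atape) : cell := t.1 t.2.

Definition displacement (d : direction) : int :=
  match d with GoLeft => -1 | Stay => 0 | GoRight => 1 end.

Definition amove (m : cell * direction) (t : atape) : atape :=
  (fun z => if z == t.2 then m.1 else t.1 z, t.2 + displacement m.2).

Definition contents (t : tape) (z : int) : cell :=
  match z with
  | Posz k => nth None (tape_right t) k
  | Negz k => nth None (tape_left t) k
  end.

(** Cellwise agreement ignores how many trailing blanks the lists of a [tape] carry. *)
Definition models (a : atape) (t : tape) : Prop :=
  forall z, a.1 (a.2 + z) = contents t z.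

(** The bound includes [size s]: the cell after the word must be blank, which makes the word
    unique. *)
Definition word_at (t : atape) (s : bitstring) : Prop :=
  forall i, (i <= size s)%N -> t.1 (t.2 + i%:Z) = nth None (map Some s) i.

Lemma amove_stay (t : atape) : amove (ascan t, Stay) t = t.
Proof.
case: t => f p; rewrite /amove /= addr0; congr pair.
by apply/funext => z; case: eqP => [->|].
Qed.

Lemma contents_shift d t z : contents (Defs.shift d t) z = contents t (z + displacement d).
Proof.
case: t => l r; case: d; rewrite ?addr0 //.
- case: z => [[|k]|k]; first by case: l.
    by have -> : Posz k.+1 + displacement GoLeft = k by rewrite /displacement; lia.
  have -> : Negz k + displacement GoLeft = Negz k.+1 by rewrite /displacement; lia.
  by case: l => //=; rewrite nth_nil.
- case: z => [k|[|k]].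
  + have -> : Posz k + displacement GoRight = k.+1 by rewrite /displacement; lia.
    by case: r => //=; rewrite nth_nil.
  + by case: r.
  + by have -> : Negz k.+1 + displacement GoRight = Negz k by rewrite /displacement; lia.
Qed.

Lemma contents_write c t z :
  contents (write c t) z = if z == 0 then c else contents t z.
Proof.
by case: t => l [|b r]; case: z => [[|k]|k] //=; rewrite !nth_nil.
Qed.

Lemma models_scan a t : models a t -> ascan a = scan t.
Proof. by move=> /(_ 0); rewrite addr0 /= nth0. Qed.

Lemma models_move m a t :
  models a t -> models (amove m a) (Defs.shift m.2 (write m.1 t)).
Proof.
move=> at_ z; rewrite contents_shift contents_write /=.
rewrite -addrA [displacement _ + z]addrC -at_.
by congr (if _ then _ else _); lia.
Qed.

Lemma models_word a t : models a t -> word_at a (word t).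
Proof.
move=> at_ i; rewrite at_ /word /=.
elim: (tape_right t) i => [|[b|] s IH] [|i] //=; exact: IH.
Qed.

Lemma word_at_inj a s s' : word_at a s -> word_at a s' -> s = s'.
Proof.
case: a => f; elim: s s' => [|b s IH] [|c s'] //= p sE s'E.
- by have := sE 0%N isT; rewrite s'E.
- by have := sE 0%N isT; rewrite s'E.
have := sE 0%N isT; rewrite s'E // => -[->]; congr cons.
have pE i : (p + 1) + Posz i = p + Posz i.+1 by lia.
by apply: (IH _ (p + 1)) => i le_i /=; rewrite pE; [exact: sE|exact: s'E].
Qed.

(** * Machines whose tapes are indexed by a finite type *)

Inductive abstract_instruction (S I : Type) :=
| AHalt
| AQuery of S
| AStep of ((I -> cell) -> S * (I -> cell * direction)).
Arguments AHalt {S I}.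
Arguments AQuery {S I}.

Section AbstractMachine.
Variables (S I : finType) (oracle_tape : I) (start : S).
Variable prog : S -> abstract_instruction S I.

Definition aconfig := (S * (I -> atape))%type.

(** A relation, since the answer to a query may lie anywhere in absolute coordinates. A halted
    configuration has no successor. *)
Definition astep (phi : bitstring -> bitstring) (c c' : aconfig) : Prop :=
  match prog c.1 with
  | AHalt => False
  | AQuery q => exists2 w, word_at (c.2 oracle_tape) w &
      exists2 t, models t (tape_of (phi w)) &
      c' = (q, fun i => if i == oracle_tape then t else c.2 i)
  | AStep delta =>
      let qa := delta (fun i => ascan (c.2 i)) in
      c' = (qa.1, fun i => amove (qa.2 i) (c.2 i))
  end.

Fixpoint apath phi (k : nat) (c c' : aconfig) : Prop :=
  if k is k'.+1 then exists2 d, astep phi c d & apath phi k' d c' else c = c'.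

Lemma apath_cat phi k l c d e :
  apath phi k c d -> apath phi l d e -> apath phi (k + l) c e.
Proof. by elim: k c => [|k IH] c /= => [-> //|[c1 s p] q]; exists c1; auto. Qed.

Lemma apath_split phi k l c e :
  apath phi (k + l) c e -> exists d, apath phi k c d /\ apath phi l d e.
Proof.
elim: k c => [|k IH] c /=; first by exists c.
by case=> c1 s /IH[d [p q]]; exists d; split=> //; exists c1.
Qed.

Lemma tape_numbering : (1 < #|I|)%N ->
  exists (n : nat) (f : 'I_n.+2 -> I) (g : I -> 'I_n.+2),
    [/\ cancel f g, cancel g f & f ord_max = oracle_tape].
Proof.
case En: #|I| => [|[|n]] // _; exists n.
pose e i := enum_val (cast_ord (esym En) i) : I.
pose e' i := cast_ord En (enum_rank i).
have ee' : cancel e' e by move=> i; rewrite /e cast_ordK enum_rankK.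
have e'e : cancel e e' by move=> i; rewrite /e' enum_valK cast_ordKV.
(* The transposition puts the oracle tape last, wherever the enumeration has it. *)
exists (fun i => e (tperm ord_max (e' oracle_tape) i)).
exists (fun i => tperm ord_max (e' oracle_tape) (e' i)); split=> [i|i|].
- by rewrite e'e tpermK.
- by rewrite tpermK ee'.
- by rewrite tpermL.
Qed.

Section Numbering.
Variables (n : nat) (f : 'I_n.+2 -> I) (g : I -> 'I_n.+2).
Hypotheses (fK : cancel f g) (gK : cancel g f) (f_max : f ord_max = oracle_tape).

Definition concrete : oracle_machine := @OracleMachine S n start (fun q =>
  match prog q with
  | AHalt => Halt
  | AQuery q' => Query q'
  | AStep delta => Step (fun cs =>
      let qa := delta (fun i => cs (g i)) in (qa.1, [ffun j => qa.2 (f j)]))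
  end).

Definition models_config (c : aconfig) (r : config concrete) : Prop :=
  c.1 = r.1 /\ forall j, models (c.2 (f j)) (r.2 j).

Lemma models_config_step phi c c' r :
  models_config c r -> astep phi c c' -> models_config c' (step phi r).
Proof.
case: c r => q T [_ ts] [/= <- Tt]; rewrite /astep /step /=.
have sE : (fun i => ascan (T i)) = (fun i => [ffun j => scan (ts j)] (g i)).
  by apply/funext => i; rewrite ffunE; apply: models_scan; have := Tt (g i); rewrite gK.
case: (prog q) => // [q' [w Tw [t tw ->]]|delta ->].
  split=> //= j; rewrite ffunE -(inj_eq (can_inj fK)) f_max; case: eqP => // _.
  have /models_word := Tt ord_max; rewrite f_max => Tw'.
  by rewrite (word_at_inj Tw' Tw).
split=> [|j]; rewrite /= -sE // !ffunE; exact: models_move.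
Qed.

Lemma models_config_init phi k c :
  apath phi k (start, fun=> ablank) c ->
  models_config c (iter k (step phi) (init concrete [::])).
Proof.
have : models_config (start, fun=> ablank) (init concrete [::]).
  by split=> //= j z; rewrite ffunE if_same; case: z => i; rewrite /= nth_nil.
elim: k (start, _) (init _ _) => [|k IH] d r dr /=; first by move=> <-.
by move=> [e de ec]; rewrite -iterS iterSr; apply: IH ec; apply: models_config_step de.
Qed.

End Numbering.

Lemma concrete_machine : (1 < #|I|)%N -> exists M : oracle_machine, forall phi,
  (forall k c, apath phi k (start, fun=> ablank) c -> prog c.1 = AHalt ->
     halts M phi [::]) /\
  ((forall k, exists l c, (k <= l)%N /\ apath phi l (start, fun=> ablank) c) ->
     ~ halts M phi [::]).
Proof.
move=> /tape_numbering[n [f [g [fK gK f_max]]]]; exists (concrete f g) => phi.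
have haltedE c r : @models_config n f g c r -> (halted r <-> prog c.1 = AHalt).
  by rewrite /halted /= => -[<- _]; case: (prog c.1).
split=> [k c /(models_config_init fK gK f_max) /haltedE kc /kc|path_l [t ht]].
  by exists k.
(* Cut after [t] steps, the path still has a step to go, which the halted configuration cannot
   make. *)
have [l [c [lt_tl]]] := path_l t.+1; rewrite -(subnKC lt_tl) addSn -addnS.
case/apath_split => d [pd] [e de _].
have /haltedE[/(_ ht)] := models_config_init fK gK f_max pd.
by move: de; rewrite /astep => + dH; rewrite dH.
Qed.

End AbstractMachine.

(** * The searching machine *)

(* The jobs [Reset], [Load] and [Ask q c] copy a string derived from the counter to
   a tape of the simulated machine: [Reset] to clean the oracle tape, [Load] to provide
   the input, [Ask q c] to serve a query made while scanning [c] and continued in [q].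
   [Fail] and [Next] only bring the head of the counter home, before cleaning up and
   before the next trial. *)
Inductive job (Q : Type) := Reset | Load | Ask of Q & cell | Fail | Next.
Arguments Reset {Q}. Arguments Load {Q}. Arguments Fail {Q}. Arguments Next {Q}.

Definition job_code Q (j : job Q) : bool * bool + Q * cell :=
  match j with
  | Reset => inl (false, false) | Load => inl (false, true)
  | Fail => inl (true, false) | Next => inl (true, true) | Ask q c => inr (q, c)
  end.

Definition job_decode Q (x : bool * bool + Q * cell) : job Q :=
  match x with
  | inl (false, false) => Reset | inl (false, true) => Load
  | inl (true, false) => Fail | inl (true, true) => Next | inr (q, c) => Ask q c
  end.

Lemma job_codeK Q : cancel (@job_code Q) (@job_decode Q).
Proof. by case. Qed.

HB.instance Definition _ (Q : finType) := Finite.copy (job Q) (can_type (@job_codeK Q)).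

(* [Blank] to [Rewind] copy from right to left, then return to the right end of the
   counter. Only a query can clean an oracle tape of unknown extent: [Call] replaces the
   tape by a word, which [Erase] can delete. [Sign] to [Verdict] test the output, [Stamp],
   [Seek] and [Sweep] delete all marked cells, [Back] and [Carry] increment the counter. *)
Inductive label (Q : Type) :=
| Blank of job Q | Pad2 of job Q | Pad1 of job Q | Zeros of job Q | Prefix of job Q
| Turn of job Q | Rewind of job Q | Call of job Q | Erase of job Q
| Run of Q
| Sign | Compare of bool | Skip2 of bool | Skip1 of bool | Verdict of bool | Success
| Stamp | Seek | Sweep | Back | Carry.
Arguments Sign {Q}. Arguments Compare {Q}. Arguments Skip2 {Q}. Arguments Skip1 {Q}.
Arguments Verdict {Q}. Arguments Success {Q}. Arguments Stamp {Q}. Arguments Seek {Q}.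
Arguments Sweep {Q}. Arguments Back {Q}. Arguments Carry {Q}.

Definition label_code Q (l : label Q) : 'I_9 * job Q + (Q + 'I_11 * bool) :=
  match l with
  | Blank j => inl (@Ordinal 9 0 isT, j) | Pad2 j => inl (@Ordinal 9 1 isT, j)
  | Pad1 j => inl (@Ordinal 9 2 isT, j) | Zeros j => inl (@Ordinal 9 3 isT, j)
  | Prefix j => inl (@Ordinal 9 4 isT, j) | Turn j => inl (@Ordinal 9 5 isT, j)
  | Rewind j => inl (@Ordinal 9 6 isT, j) | Call j => inl (@Ordinal 9 7 isT, j)
  | Erase j => inl (@Ordinal 9 8 isT, j)
  | Run q => inr (inl q)
  | Sign => inr (inr (@Ordinal 11 0 isT, true))
  | Compare b => inr (inr (@Ordinal 11 1 isT, b))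
  | Skip2 b => inr (inr (@Ordinal 11 2 isT, b))
  | Skip1 b => inr (inr (@Ordinal 11 3 isT, b))
  | Verdict b => inr (inr (@Ordinal 11 4 isT, b))
  | Success => inr (inr (@Ordinal 11 5 isT, true))
  | Stamp => inr (inr (@Ordinal 11 6 isT, true))
  | Seek => inr (inr (@Ordinal 11 7 isT, true))
  | Sweep => inr (inr (@Ordinal 11 8 isT, true))
  | Back => inr (inr (@Ordinal 11 9 isT, true))
  | Carry => inr (inr (@Ordinal 11 10 isT, true))
  end.

Definition label_decode Q (x : 'I_9 * job Q + (Q + 'I_11 * bool)) : label Q :=
  match x with
  | inl (i, j) =>
      match val i with
      | 0 => Blank j | 1 => Pad2 j | 2 => Pad1 j | 3 => Zeros j | 4 => Prefix j
      | 5 => Turn j | 6 => Rewind j | 7 => Call j | _ => Erase j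
      end%N
  | inr (inl q) => Run q
  | inr (inr (i, b)) =>
      match val i with
      | 0 => Sign | 1 => Compare b | 2 => Skip2 b | 3 => Skip1 b | 4 => Verdict b
      | 5 => Success | 6 => Stamp | 7 => Seek | 8 => Sweep | 9 => Back | _ => Carry
      end%N
  end.

Lemma label_codeK Q : cancel (@label_code Q) (@label_decode Q).
Proof. by case. Qed.

HB.instance Definition _ (Q : finType) :=
  Finite.copy (label Q) (can_type (@label_codeK Q)).

(* Counter strings are reversed, the last letter of the trial first. *)
Fixpoint inc (r : bitstring) : bitstring :=
  match r with
  | true :: r' => false :: inc r'
  | false :: r' => true :: r'
  | [::] => [:: false]
  end.

Lemma nat_of_str_rcons w b : nat_of_str (rcons w b) = ((nat_of_str w).*2 + b).+1.
Proof. by rewrite /nat_of_str -cats1 foldl_cat. Qed.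

(** [nat_of_str] is bijective base two, the letter [b] being the digit [b + 1]; a carry turns the
    digit 2 into 1. *)
Lemma nat_of_str_inc r : nat_of_str (rev (inc r)) = (nat_of_str (rev r)).+1.
Proof.
elim: r => [|[] r IH] //=; rewrite !rev_cons !nat_of_str_rcons ?IH //.
  by rewrite doubleS !addn0 addn1.
by rewrite addn0 addn1.
Qed.

(** This lets a search that counts up from the empty string get to any given trial. *)
Lemma iter_inc r : exists n, iter n inc [::] = r.
Proof.
exists (nat_of_str (rev r)); apply: (can_inj revK); apply: (bij_inj nat_of_str_bij).
elim: (nat_of_str (rev r)) => //= n IH; first by rewrite nat_of_str_inc IH.
Qed.

(* From the trial w 1 0^j or 0^j (with w empty): [Plain] is w, [Padded] is w 0^(j+2) and
   [Flat] has as many zeros as the trial has letters, plus two; all reversed. *)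
Inductive mode := Plain | Padded | Flat.

Fixpoint cut (m : mode) (r : bitstring) : bitstring :=
  match r with
  | false :: r' => if m is Plain then cut m r' else false :: cut m r'
  | true :: r' => if m is Flat then false :: cut m r' else r'
  | [::] => [::]
  end.

Definition copied (m : mode) (r : bitstring) : bitstring :=
  (if m is Plain then [::] else [:: false; false]) ++ cut m r.

(* [v] is the output without its sign, [r] what is left of the counter, and [f] tells
   whether a 1 has been read; see [pass_false] for the number being compared. *)
Fixpoint pass (f : bool) (r v : bitstring) : bool :=
  match r, v with
  | false :: r', b :: v' => pass (f || b) r' v'
  | false :: r', [::] => false
  | _, [:: _; _] => f
  | _, _ => (2 < size v)%N
  end.

Definition accepts (r v : bitstring) : bool :=
  if v is false :: v' then pass false r v' else false.

Section Machine.
Variable K : oracle_machine.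
Notation Q := (om_state K).
Notation n := (om_work K).+2.

(* The counter, the tapes of [K], and for each of these a tape whose marks record the
   cells that [K] has visited. *)
Definition tape_name := option (bool * 'I_n).
Notation Count := (None : tape_name).
Notation Work i := (Some (false, i) : tape_name).
Notation Mark i := (Some (true, i) : tape_name).

Definition moves := ('I_n -> cell * direction)%type.

Definition on (o : option 'I_n) (m : cell * direction) (s : 'I_n -> cell) : moves :=
  fun i => if o == Some i then m else (s i, Stay).

(** Each mark tape follows the head of its work tape and marks the cell that the head was on. *)
Definition act (d : ('I_n -> cell) -> cell -> label Q * moves * (cell * direction)) :
    abstract_instruction (label Q) tape_name :=
  AStep (fun s => let a := d (fun i => s (Work i)) (s Count) in
    (a.1.1, fun t => match t with
                     | None => a.2
                     | Some (false, i) => a.1.2 i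
                     | Some (true, i) => (Some true, (a.1.2 i).2)
                     end)).

Definition target (j : job Q) : option 'I_n :=
  match j with Reset | Ask _ _ => Some ord_max | Load => Some ord0 | _ => None end.

Definition copy_mode (j : job Q) : mode :=
  match j with Load => Padded | Ask _ (Some true) => Flat | _ => Plain end.

Definition after_copy (j : job Q) : label Q :=
  match j with
  | Reset | Ask _ _ => Call j
  | Load => Run (om_start K)
  | Fail => Stamp
  | Next => Blank Reset
  end.

(** A pair answers the empty query, recognized by the blank in [Ask q None], with the empty word;
    what the real oracle returned is therefore erased. *)
Definition after_call (j : job Q) : label Q :=
  if j is Ask q (Some _) then Run q else Erase j.

Definition after_erase (j : job Q) : label Q :=
  if j is Ask q _ then Run q else Blank Load.

Definition prog (l : label Q) : abstract_instruction (label Q) tape_name :=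
  match l with
  | Blank j => act (fun s a => (if copy_mode j is Plain then Zeros j else Pad2 j,
                                on (target j) (None, GoLeft) s, (a, GoLeft)))
  | Pad2 j => act (fun s a => (Pad1 j, on (target j) (Some false, GoLeft) s, (a, Stay)))
  | Pad1 j => act (fun s a => (Zeros j, on (target j) (Some false, GoLeft) s, (a, Stay)))
  | Zeros j => act (fun s a =>
      match a with
      | Some false => (Zeros j, on (if copy_mode j is Plain then None else target j)
                                   (Some false, GoLeft) s, (a, GoLeft))
      | Some true =>
          if copy_mode j is Flat
          then (Zeros j, on (target j) (Some false, GoLeft) s, (a, GoLeft))
          else (Prefix j, on None (a, Stay) s, (a, GoLeft))
      | None => (Turn j, on None (a, Stay) s, (a, Stay))
      end)
  | Prefix j => act (fun s a =>
      if a is Some _ then (Prefix j, on (target j) (a, GoLeft) s, (a, GoLeft))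
      else (Turn j, on None (a, Stay) s, (a, Stay)))
  | Turn j => act (fun s a =>
      (Rewind j, fun i => if target j == Some i then (s i, GoRight) else (s i, Stay),
       (a, GoRight)))
  | Rewind j => act (fun s a =>
      if a is Some _ then (Rewind j, on None (a, Stay) s, (a, GoRight))
      else (after_copy j, on None (a, Stay) s, (a, Stay)))
  | Call j => AQuery (after_call j)
  | Erase j => act (fun s a =>
      if s ord_max is Some _
      then (Erase j, on (Some ord_max) (None, GoRight) s, (a, Stay))
      else (after_erase j, on None (a, Stay) s, (a, Stay)))
  | Run q =>
      match om_prog q with
      | Halt => act (fun s a => (Sign, on None (a, Stay) s, (a, GoLeft)))
      | Query q' => act (fun s a => (Blank (Ask q' (s ord_max)), on None (a, Stay) s, (a, Stay)))
      | Step delta => act (fun s a =>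
          let qa := delta [ffun i => s i] in (Run qa.1, fun i => qa.2 i, (a, Stay)))
      end
  | Sign => act (fun s a =>
      if s ord0 is Some false then (Compare false, on (Some ord0) (s ord0, GoRight) s, (a, Stay))
      else (Turn Fail, on None (a, Stay) s, (a, Stay)))
  | Compare f => act (fun s a =>
      if a is Some false then
        if s ord0 is Some b
        then (Compare (f || b), on (Some ord0) (s ord0, GoRight) s, (a, GoLeft))
        else (Turn Fail, on None (a, Stay) s, (a, Stay))
      else (Skip2 f, on None (a, Stay) s, (a, Stay)))
  | Skip2 f => act (fun s a =>
      if s ord0 is Some _ then (Skip1 f, on (Some ord0) (s ord0, GoRight) s, (a, Stay))
      else (Turn Fail, on None (a, Stay) s, (a, Stay)))
  | Skip1 f => act (fun s a =>
      if s ord0 is Some _ then (Verdict f, on (Some ord0) (s ord0, GoRight) s, (a, Stay))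
      else (Turn Fail, on None (a, Stay) s, (a, Stay)))
  | Verdict f => act (fun s a =>
      (if f || (s ord0 != None) then Success else Turn Fail, on None (a, Stay) s, (a, Stay)))
  | Success => AHalt
  (* A move that stays put also marks the scanned cell, the only visited one that may lack its
     mark. *)
  | Stamp => act (fun s a => (Seek, on None (a, Stay) s, (a, Stay)))
  (* Not an [act], which would set new marks. Each head walks right until it leaves its marks; when
     all have done so, all step back onto their last mark. *)
  | Seek => AStep (fun s =>
      if [exists i, (i != ord_max) && (s (Mark i) != None)]
      then (Seek, fun t => if t is Some (_, i) then
                    if (i != ord_max) && (s (Mark i) != None) then (s t, GoRight)
                    else (s t, Stay) else (s t, Stay))
      else (Sweep, fun t => if t is Some (_, i) then
                     if i != ord_max then (s t, GoLeft) else (s t, Stay)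
                     else (s t, Stay)))
  | Sweep => AStep (fun s =>
      if [exists i, (i != ord_max) && (s (Mark i) != None)]
      then (Sweep, fun t => if t is Some (_, i) then
                    if (i != ord_max) && (s (Mark i) != None) then (None, GoLeft)
                    else (s t, Stay) else (s t, Stay))
      else (Back, fun t => (s t, Stay)))
  | Back => act (fun s a => (Carry, on None (a, Stay) s, (a, GoLeft)))
  | Carry => act (fun s a =>
      match a with
      | Some true => (Carry, on None (a, Stay) s, (Some false, GoLeft))
      | Some false => (Turn Next, on None (a, Stay) s, (Some true, Stay))
      | None => (Turn Next, on None (a, Stay) s, (Some false, Stay))
      end)
  end.

Arguments ascan : simpl never.

(** * Runs of the searching machine, phase by phase *)

Section Leads.
Variable phi : bitstring -> bitstring.
Notation path := (apath (Work ord_max) prog phi).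

Definition state := (label Q * ('I_n -> atape) * atape)%type.

(* The scanned cell is exempt: it receives its mark when the head leaves it. *)
Definition covered (t m : atape) : Prop :=
  m.2 = t.2 /\ exists lo hi : int, lo <= t.2 <= hi /\ forall z, z != t.2 ->
    m.1 z = (if lo <= z <= hi then Some true else None) /\
    (t.1 z != None -> lo <= z <= hi).

Definition represents (c : aconfig (label Q) tape_name) (x : state) : Prop :=
  [/\ c.1 = x.1.1, forall i, c.2 (Work i) = x.1.2 i, c.2 Count = x.2 &
      forall i, i != ord_max -> covered (x.1.2 i) (c.2 (Mark i))].

(* A state leaves the marks open, hence the quantification over all configurations. *)
Definition leads (x y : state) : Prop :=
  forall c, represents c x -> exists k d, path k c d /\ represents d y.

Lemma leads_refl x : leads x x.
Proof. by move=> c cx; exists 0%N, c. Qed.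

Lemma leads_trans y x z : leads x y -> leads y z -> leads x z.
Proof.
move=> xy yz c /xy[k [d [p /yz[l [e [q ez]]]]]].
by exists (k + l)%N, e; split=> //; apply: apath_cat q.
Qed.

(** The interval grows at most by the newly scanned cell, which is exempt, and the cell left behind
    has just received its mark. *)
Lemma covered_move t m mv :
  covered t m -> covered (amove mv t) (amove (Some true, mv.2) m).
Proof.
case: t m => f p [g p'] [/= -> [lo [hi [/andP[lop phi'] gE]]]].
split=> //; exists (Order.min lo (p + displacement mv.2)), (Order.max hi (p + displacement mv.2)).
split=> [|z] /=; first by lia.
move=> zp.
case: (eqVneq z p) zp => [-> zp|zp' zp].
  have -> : Order.min lo (p + displacement mv.2) <= p <= Order.max hi (p + displacement mv.2).
    by lia.
  by split.
have [-> fz] := gE z zp'.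
suff -> : (Order.min lo (p + displacement mv.2) <= z <= Order.max hi (p + displacement mv.2))
    = (lo <= z <= hi) by split.
by case: mv.2 zp => /=; lia.
Qed.

Definition after_act d (X : 'I_n -> atape) (a : atape) : state :=
  let r := d (fun i => ascan (X i)) (ascan a) in
  (r.1.1 : label Q, fun i => amove (r.1.2 i : cell * direction) (X i), amove r.2 a).

Lemma leads_act d l X a : prog l = act d -> leads (l, X, a) (after_act d X a).
Proof.
move=> ld [l' T] [/= -> TX Ta Tc]; pose c := (l, T); exists 1%N; eexists; split.
  by eexists; last reflexivity; rewrite /astep /= ld.
have sE : (fun i => ascan (T (Work i))) = fun i => ascan (X i).
  by apply/funext => i; rewrite TX.
split=> [|i||i iM] /=; rewrite ?sE ?TX ?Ta //; exact/covered_move/Tc.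
Qed.

Lemma lead d l X a y : prog l = act d -> leads (after_act d X a) y -> leads (l, X, a) y.
Proof. by move=> ld; apply: leads_trans; exact: leads_act. Qed.

Definition upd (o : option 'I_n) (g : atape -> atape) (X : 'I_n -> atape) :=
  fun i => if o == Some i then g (X i) else X i.

Lemma amove_on o m X :
  (fun i => amove (on o m (fun i => ascan (X i)) i) (X i)) = upd o (amove m) X.
Proof.
by apply/funext => i; rewrite /on /upd; case: eqP => // _; rewrite amove_stay.
Qed.

Lemma upd_None g X : upd None g X = X.
Proof. by []. Qed.

Lemma upd_upd o g h X : upd o g (upd o h X) = upd o (g \o h) X.
Proof. by apply/funext => i; rewrite /upd; case: eqP. Qed.

Lemma upd_id o X : upd o id X = X.
Proof. by apply/funext => i; rewrite /upd if_same. Qed.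

Lemma amove_scan t c d : ascan t = c -> amove (c, d) t = (t.1, t.2 + displacement d).
Proof.
move=> <-; rewrite /amove /=; congr pair.
by apply/funext => z; case: eqP => [->|].
Qed.

Lemma amove_scan_stay t c : ascan t = c -> amove (c, Stay) t = t.
Proof. by move=> <-; rewrite amove_stay. Qed.

Definition reads (a : atape) (r : bitstring) : Prop :=
  forall i : nat, a.1 (a.2 - i%:Z) = nth None (map Some r) i.

Lemma reads_scan a r : reads a r -> ascan a = nth None (map Some r) 0.
Proof. by move=> /(_ 0%N); rewrite subr0. Qed.

Lemma reads_cons f p b r : reads (f, p) (b :: r) -> reads (f, p - 1) r.
Proof. by move=> ar i; have := ar i.+1 => /= <-; congr f; lia. Qed.

(** Writing towards the left reverses [s]; the head ends one cell before the word. *)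
Definition pushes (s : bitstring) (t : atape) : atape :=
  foldl (fun t b => amove (Some b, GoLeft) t) t s.

Lemma prefix_leads j X f p r : reads (f, p) r ->
  leads (Prefix j, X, (f, p))
        (Turn j, upd (target j) (pushes r) X, (f, p - (size r)%:Z)).
Proof.
elim: r p X => [|b r IH] p X ar; (eapply lead; [reflexivity|]);
  rewrite /after_act (reads_scan ar) /= amove_on.
  rewrite upd_None (upd_id (target j)) subr0 amove_scan_stay ?(reads_scan ar) //.
  exact: leads_refl.
rewrite (amove_scan _ (reads_scan ar)) /=.
have := IH _ (upd (target j) (amove (Some b, GoLeft)) X) (reads_cons ar).
rewrite upd_upd; have -> : p - 1 - (size r)%:Z = p - (size r).+1%:Z by lia.
exact.
Qed.

Lemma zeros_leads j X f p r : reads (f, p) r ->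
  leads (Zeros j, X, (f, p))
        (Turn j, upd (target j) (pushes (cut (copy_mode j) r)) X, (f, p - (size r)%:Z)).
Proof.
elim: r p X => [|b r IH] p X ar; (eapply lead; [reflexivity|]);
  rewrite /after_act (reads_scan ar) /=.
  rewrite amove_on upd_None (upd_id (target j)) subr0 amove_scan_stay ?(reads_scan ar) //.
  exact: leads_refl.
have pE : p - 1 - (size r)%:Z = p - (size r).+1%:Z by lia.
case: b ar => ar /=.
  case: (copy_mode j) IH => IH; rewrite amove_on (amove_scan _ (reads_scan ar)) /= -pE;
    try by apply: prefix_leads; exact: reads_cons ar.
  have := IH _ (upd (target j) (amove (Some false, GoLeft)) X) (reads_cons ar).
  by rewrite upd_upd.
rewrite amove_on (amove_scan _ (reads_scan ar)) /= -pE.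
have := IH _ (upd (if copy_mode j is Plain then None else target j)
  (amove (Some false, GoLeft)) X) (reads_cons ar).
by case: (copy_mode j) => //; rewrite upd_upd.
Qed.

(** The letters fill the negative cells leftwards; cell 0 is the blank at which [Rewind] stops. *)
Definition counter (r : bitstring) (z : int) : cell :=
  if z is Negz i then nth None (map Some r) i else None.

Lemma reads_counter r : reads (counter r, -1) r.
Proof. by move=> i /=; have -> : -1 - Posz i = Negz i by lia. Qed.

Lemma rewind_leads j X r k : (k <= size r)%N ->
  leads (Rewind j, X, (counter r, - k%:Z)) (after_copy j, X, (counter r, 0)).
Proof.
elim: k => [|k IH] kr; (eapply lead; [reflexivity|]).
  rewrite /after_act /= amove_on upd_None amove_scan_stay //; exact: leads_refl.
have sE : ascan (counter r, - k.+1%:Z) = Some (nth false r k).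
  by rewrite /ascan /= -(nth_map _ None).
rewrite /after_act sE /= amove_on upd_None (amove_scan _ sE) /=.
have -> : - Posz k.+1 + 1 = - k%:Z by lia.
by apply: IH; exact: ltnW.
Qed.

(** The position is arbitrary because a failing test or a finished carry may leave the head in the
    middle of the counter. *)
Lemma turn_leads j X r k : (k <= size r)%N ->
  leads (Turn j, X, (counter r, -1 - k%:Z))
    (after_copy j, upd (target j) (fun t => (t.1, t.2 + 1)) X, (counter r, 0)).
Proof.
move=> kr; (eapply lead; [reflexivity|]).
rewrite /after_act /= (amove_scan _ erefl) /=.
have -> : -1 - Posz k + 1 = - Posz k by lia.
rewrite [X in (_, X, _)](_ : _ = upd (target j) (fun t => (t.1, t.2 + 1)) X).
  exact: rewind_leads.
apply/funext => i; rewrite /upd; case: ifP => // _; last by rewrite amove_stay.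
by rewrite (amove_scan _ erefl).
Qed.

Definition copy (s : bitstring) (t : atape) : atape :=
  let t' := pushes s (amove (None, GoLeft) t) in (t'.1, t'.2 + 1).

Lemma copy_leads j X r :
  leads (Blank j, X, (counter r, 0))
    (after_copy j, upd (target j) (copy (copied (copy_mode j) r)) X, (counter r, 0)).
Proof.
(eapply lead; [reflexivity|]).
rewrite /after_act /= amove_on (amove_scan _ erefl) /= sub0r.
suff H Y : leads (Zeros j, Y, (counter r, -1)) (after_copy j,
    upd (target j) (fun t => let t' := pushes (cut (copy_mode j) r) t in (t'.1, t'.2 + 1)) Y,
    (counter r, 0)).
  rewrite /copy /copied.
  case: (copy_mode j) H => H.
    by have := H (upd (target j) (amove (None, GoLeft)) X); rewrite upd_upd.
  1-2: do 2![(eapply lead; [reflexivity|]); rewrite /after_act /= amove_on amove_stay].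
  1-2: (eapply leads_trans; [exact: H|]); rewrite !upd_upd; exact: leads_refl.
eapply leads_trans; [apply: zeros_leads; exact: reads_counter|].
(eapply leads_trans; [apply: turn_leads; exact: leqnn|]); rewrite upd_upd; exact: leads_refl.
Qed.

Arguments copy_leads : clear implicits.

Lemma pushes_cons s b t : pushes (rcons s b) t = amove (Some b, GoLeft) (pushes s t).
Proof. by rewrite /pushes -cats1 foldl_cat. Qed.

Lemma pushes_word s t : t.1 (t.2 + 1) = None ->
  word_at ((pushes s t).1, (pushes s t).2 + 1) (rev s).
Proof.
move=> t0; elim/last_ind: s => [|s b IH]; first by case=> //= _; rewrite addr0.
rewrite pushes_cons rev_rcons; case: (pushes s t) IH => f p IH [|i] /= ile.
  by rewrite (_ : p - 1 + 1 + Posz 0 = p) ?eqxx //; lia.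
have -> : p - 1 + 1 + Posz i.+1 = p + 1 + i%:Z by lia.
have -> : (p + 1 + i%:Z == p) = false by lia.
exact: IH.
Qed.

(** The blank written first ends the word whatever [t] held before. A query depends on the word
    alone, so this suffices for an oracle tape with remains of earlier use. *)
Lemma copy_word s t : word_at (copy s t) (rev s).
Proof. by apply: pushes_word => /=; rewrite subrK eqxx. Qed.

Lemma pushes_models s t : models (t.1, t.2 + 1) (tape_of [::]) ->
  models ((pushes s t).1, (pushes s t).2 + 1) (tape_of (rev s)).
Proof.
move=> t0; elim/last_ind: s => [|s b IH] //.
rewrite pushes_cons rev_rcons; case: (pushes s t) IH => f p IH z /=.
have -> : p - 1 + 1 + z = p + z by lia.
case: eqVneq => [|zp]; first by case: z => [[|z]|z] //= /eqP; lia.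
have := IH (z - 1); rewrite /=; have -> : p + 1 + (z - 1) = p + z by lia.
move=> ->; case: z zp => [[|z]|z] zp //; first by case/eqP: zp; lia.
  by have -> : Posz z.+1 - 1 = z by lia.
by rewrite (_ : Negz z - 1 = Negz z.+1) /= ?nth_nil //; lia.
Qed.

Lemma copy_models s t : (forall z, t.1 z = None) -> models (copy s t) (tape_of (rev s)).
Proof.
move=> t0; apply: pushes_models => z /=; rewrite t0 if_same.
by case: z => i; rewrite /= nth_nil.
Qed.

Lemma query_leads j X a w : word_at (X ord_max) w ->
  leads (Call j, X, a)
    (after_call j, upd (Some ord_max) (fun=> (contents (tape_of (phi w)), 0)) X, a).
Proof.
move=> Xw [l T] [/= -> TX Ta Tc].
exists 1%N; eexists; split.
  eexists; last reflexivity; rewrite /astep /=; exists w; first by rewrite TX.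
  by exists (contents (tape_of (phi w)), 0); last reflexivity; move=> z; rewrite add0r.
split=> //= [i|i iM]; rewrite /upd.
  by rewrite !(inj_eq Some_inj) xpair_eqE eqxx /= [i == _]eq_sym; case: eqP.
by rewrite (inj_eq Some_inj) eq_sym (negbTE iM); exact: Tc.
Qed.

Arguments query_leads {j X} a {w} _.

Lemma erase_leads j X a v : models (X ord_max) (tape_of v) ->
  exists2 t, forall z, t.1 z = None &
    leads (Erase j, X, a) (after_erase j, upd (Some ord_max) (fun=> t) X, a).
Proof.
elim: v X => [|b v IH] X Xv; have sE := models_scan Xv.
  exists (X ord_max) => [z|].
    rewrite -[z](subrKC (X ord_max).2) Xv.
    by case: (z - _) => i; rewrite /= nth_nil.
  (eapply lead; [reflexivity|]).
  rewrite /after_act sE /= amove_on upd_None amove_stay.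
  rewrite [X in leads _ (_, X, _)](_ : _ = X); first exact: leads_refl.
  by apply/funext => i; rewrite /upd; case: eqP => // -[->].
have [|t t0 le_t] := IH (upd (Some ord_max) (amove (None, GoRight)) X).
  rewrite /upd eqxx => z; rewrite (models_move (None, GoRight) Xv).
  by case: z => // -[|i] //=; rewrite !nth_nil.
exists t => //; (eapply lead; [reflexivity|]).
rewrite /after_act sE /= amove_on amove_stay; (eapply leads_trans; [exact: le_t|]).
rewrite upd_upd; exact: leads_refl.
Qed.


Lemma word_at_scan t v : word_at t v -> ascan t = nth None (map Some v) 0.
Proof. by move=> /(_ 0%N isT); rewrite addr0. Qed.

Lemma word_at_behead t b v : word_at t (b :: v) -> word_at (t.1, t.2 + 1) v.
Proof.
by move=> tv i iv; have := tv i.+1 iv => /= <-; congr (t.1 _); lia.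
Qed.

(** * A single trial: simulated run and test of its output *)

Section Trial.
Variable r : bitstring.

Notation home := (counter r, 0 : int).

(* A name of a pair of constants: the answer to a query depends on its first bit only. *)
Definition answers : bitstring -> bitstring :=
  baire_pair (fun=> phi (rev (copied Plain r))) (fun=> phi (rev (copied Flat r))).

(** To serve a query only the scanned cell of the oracle tape is inspected; the word actually asked
    is rebuilt from the counter. *)
Lemma run_step (c : config K) X : (forall i, models (X i) (c.2 i)) ->
  exists2 X', leads (Run c.1, X, home) (Run (step answers c).1, X', home) &
    forall i, models (X' i) ((step answers c).2 i).
Proof.
case: c => q T /= XT; rewrite /step /=.
case E: (om_prog q) => [|q'|delta]; first by exists X => //; exact: leads_refl.
  have scanE := models_scan (XT ord_max).
  have startE : leads (Run q, X, home) (Blank (Ask q' (scan (T ord_max))), X, home).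
    eapply lead; first by rewrite /= E.
    by rewrite /after_act /= amove_on upd_None amove_stay scanE; exact: leads_refl.
  have callE := leads_trans startE (copy_leads _ _ _).
  set Y := upd _ _ _ in callE.
  have Yw : word_at (Y ord_max) (rev (copied (copy_mode (Ask q' (scan (T ord_max)))) r)).
    by rewrite /Y /upd /= eqxx; exact: copy_word.
  have {callE} := leads_trans callE (query_leads home Yw).
  have tw w : models (contents (tape_of (phi w)), 0) (tape_of (phi w)).
    by move=> z; rewrite add0r.
  have YT i : i != ord_max -> models (Y i) (T i).
    by rewrite /Y /upd (inj_eq Some_inj) eq_sym => /negbTE ->.
  (* An empty list and a leading [None] both encode the empty query, so the first and third cases
     agree. *)
  case: (T ord_max) => lt [|[b|] rt] /= callE.
  - set Z := upd _ _ _ in callE.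
    have [|t t0 erase] := @erase_leads (Ask q' None) Z home (phi (rev (copied Plain r))).
      by rewrite /Z /upd eqxx; exact: tw.
    exists (upd (Some ord_max) (fun=> t) Z); first exact: leads_trans callE erase.
    move=> i; rewrite ffunE /Z /upd (inj_eq Some_inj) [_ == i]eq_sym.
    case: eqVneq => [_ z|/YT //].
    by rewrite t0; case: z => k; rewrite /= nth_nil.
  - eexists; first exact: callE.
    move=> i; rewrite ffunE /upd (inj_eq Some_inj) [_ == i]eq_sym.
    case: eqVneq => [_|/YT //]; case: b {callE Yw} => /=; exact: tw.
  - set Z := upd _ _ _ in callE.
    have [|t t0 erase] := @erase_leads (Ask q' None) Z home (phi (rev (copied Plain r))).
      by rewrite /Z /upd eqxx; exact: tw.
    exists (upd (Some ord_max) (fun=> t) Z); first exact: leads_trans callE erase.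
    move=> i; rewrite ffunE /Z /upd (inj_eq Some_inj) [_ == i]eq_sym.
    case: eqVneq => [_ z|/YT //].
    by rewrite t0; case: z => k; rewrite /= nth_nil.
set qa := delta _; exists (fun i => amove (qa.2 i) (X i)); last first.
  by move=> i; rewrite ffunE; exact: models_move.
eapply lead; first by rewrite /= E.
rewrite /after_act /= amove_stay; set qa' := delta _.
have -> : qa' = qa by congr delta; apply/ffunP => i; rewrite !ffunE; exact: models_scan.
exact: leads_refl.
Qed.

Lemma run_leads (c : config K) X k : (forall i, models (X i) (c.2 i)) ->
  exists2 X', leads (Run c.1, X, home) (Run (iter k (step answers) c).1, X', home) &
    forall i, models (X' i) ((iter k (step answers) c).2 i).
Proof.
move=> Xc; elim: k => [|k [Y XY Yc]]; first by exists X => //; exact: leads_refl.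
have [Z YZ Zc] := run_step Yc; exists Z => //; exact: leads_trans XY YZ.
Qed.

Definition blank (t : atape) := forall z, t.1 z = None.

(** [Call] replaces whatever the previous trial left on the oracle tape by an exact word, which can
    then be erased. *)
Lemma reset_leads X : (forall i, i != ord_max -> blank (X i)) ->
  exists2 X', leads (Blank Reset, X, home) (Blank Load, X', home) &
    forall i, blank (X' i).
Proof.
move=> X0; have callE := copy_leads Reset X r; set Y := upd _ _ _ in callE.
have Yw : word_at (Y ord_max) (rev (copied Plain r)).
  by rewrite /Y /upd /= eqxx; exact: copy_word.
have {callE} := leads_trans callE (query_leads home Yw).
set Z := upd _ _ _ => callE.
have [|t t0 erase] := @erase_leads Reset Z home (phi (rev (copied Plain r))).
  by rewrite /Z /upd eqxx => z; rewrite add0r.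
exists (upd (Some ord_max) (fun=> t) Z); first exact: leads_trans callE erase.
move=> i; rewrite /Z /Y /upd /= (inj_eq Some_inj) [_ == i]eq_sym.
by case: eqVneq => // /X0.
Qed.

Lemma load_leads X : (forall i, blank (X i)) ->
  exists2 X', leads (Blank Load, X, home) (Run (om_start K), X', home) &
    forall i, models (X' i) ((init K (rev (copied Padded r))).2 i).
Proof.
move=> X0; eexists; first exact: copy_leads.
move=> i; rewrite ffunE /upd (inj_eq Some_inj) [_ == i]eq_sym.
case: eqP => _; first by apply: copy_models; exact: X0.
by move=> z; rewrite X0; case: z => k; rewrite /= nth_nil.
Qed.

Definition test_ends (x : state) (b : bool) : Prop :=
  exists X, if b then exists a, leads x (Success, X, a)
  else exists2 k, (k <= size r)%N & leads x (Turn Fail, X, (counter r, -1 - k%:Z)).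

Lemma test_ends_trans y x b : leads x y -> test_ends y b -> test_ends x b.
Proof.
move=> xy [X]; case: b => [[a yz]|[k kr yz]]; exists X.
  by exists a; exact: leads_trans xy yz.
by exists k => //; exact: leads_trans xy yz.
Qed.

Lemma test_fails X k : (k <= size r)%N ->
  test_ends (Turn Fail, X, (counter r, -1 - k%:Z)) false.
Proof. by move=> kr; exists X, k => //; exact: leads_refl. Qed.

Lemma verdict_ends f X k v : (k <= size r)%N -> word_at (X ord0) v ->
  test_ends (Verdict f, X, (counter r, -1 - k%:Z)) (f || (v != [::])).
Proof.
move=> kr Xv.
eapply test_ends_trans; first by eapply lead; [reflexivity|]; exact: leads_refl.
rewrite /after_act /= amove_on upd_None amove_stay (word_at_scan Xv).
have -> : (nth None (map Some v) 0 != None) = (v != [::]) by case: (v).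
case: (f || _); last exact: test_fails.
by exists X, (counter r, -1 - k%:Z); exact: leads_refl.
Qed.

Lemma skip1_ends f X k v : (k <= size r)%N -> word_at (X ord0) v ->
  test_ends (Skip1 f, X, (counter r, -1 - k%:Z))
    (if v is _ :: v' then f || (v' != [::]) else false).
Proof.
move=> kr Xv.
eapply test_ends_trans; first by eapply lead; [reflexivity|]; exact: leads_refl.
have sE := word_at_scan Xv; rewrite /after_act sE.
case: v Xv sE => [|b v] Xv sE /=; rewrite amove_on amove_stay.
  by rewrite upd_None; exact: test_fails.
apply: verdict_ends => //; rewrite /upd eqxx (amove_scan _ sE).
exact: word_at_behead Xv.
Qed.

Lemma skip2_ends f X k v : (k <= size r)%N -> word_at (X ord0) v ->
  test_ends (Skip2 f, X, (counter r, -1 - k%:Z)) (pass f [::] v).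
Proof.
move=> kr Xv.
eapply test_ends_trans; first by eapply lead; [reflexivity|]; exact: leads_refl.
have sE := word_at_scan Xv; rewrite /after_act sE.
case: v Xv sE => [|b v] Xv sE /=; rewrite amove_on amove_stay.
  by rewrite upd_None; exact: test_fails.
have Yv : word_at (upd (Some ord0) (amove (Some b, GoRight)) X ord0) v.
  by rewrite /upd eqxx (amove_scan _ sE); exact: word_at_behead Xv.
have := skip1_ends f kr Yv.
by case: v {Yv Xv sE} => [|c [|d v]] //=; rewrite ?orbF ?orbT.
Qed.

Lemma compare_ends f X k s v : (size s + k)%N = size r ->
  reads (counter r, -1 - k%:Z) s -> word_at (X ord0) v ->
  test_ends (Compare f, X, (counter r, -1 - k%:Z)) (pass f s v).
Proof.
elim: s f X k v => [|a s IH] f X k v skr ar Xv.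
  eapply test_ends_trans; first by eapply lead; [reflexivity|]; exact: leads_refl.
  rewrite /after_act (reads_scan ar) /= amove_on upd_None (amove_scan_stay (reads_scan ar)).
  by apply: skip2_ends => //; lia.
have kr : (k <= size r)%N by rewrite /= in skr; lia.
eapply test_ends_trans; first by eapply lead; [reflexivity|]; exact: leads_refl.
rewrite /after_act (reads_scan ar); have aE := reads_scan ar.
case: a ar skr aE => ar skr aE /=.
  by rewrite amove_on upd_None (amove_scan_stay aE); have := skip2_ends f kr Xv; case: (v).
rewrite (word_at_scan Xv); have sE := word_at_scan Xv.
case: v Xv sE => [|b v] Xv sE /=; rewrite amove_on.
  by rewrite upd_None (amove_scan_stay aE); exact: test_fails.
rewrite (amove_scan _ aE) /=.
have kE : -1 - Posz k - 1 = -1 - k.+1%:Z by lia.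
rewrite kE; apply: IH => [||].
- by rewrite addnS -addSn.
- by have := reads_cons ar; rewrite kE.
- by rewrite /upd eqxx (amove_scan _ sE); exact: word_at_behead Xv.
Qed.

Lemma run_ends q X v : om_prog q = Halt -> word_at (X ord0) v ->
  test_ends (Run q, X, home) (accepts r v).
Proof.
move=> qH Xv.
eapply test_ends_trans.
  by eapply lead; [rewrite /= qH; reflexivity|]; exact: leads_refl.
rewrite /after_act /= amove_on upd_None (amove_scan _ erefl) /= sub0r.
have -> : -1 = -1 - Posz 0 by lia.
eapply test_ends_trans; first by eapply lead; [reflexivity|]; exact: leads_refl.
rewrite /after_act (word_at_scan Xv); have sE := word_at_scan Xv.
case: v Xv sE => [|[] v] Xv sE /=; rewrite amove_on amove_stay ?upd_None;
  try exact: test_fails.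
apply: compare_ends; rewrite ?addn0 ?subr0 //; first exact: reads_counter.
by rewrite /upd eqxx (amove_scan _ sE); exact: word_at_behead Xv.
Qed.

End Trial.

(** * Cleaning the tapes between trials *)

Section Clean.
Implicit Type T : tape_name -> atape.

(** What [covered] becomes once the scanned cell has its mark too; the interval may be empty. *)
Definition marked T i (lo hi : int) : Prop :=
  [/\ (T (Mark i)).2 = (T (Work i)).2,
      forall z, (T (Mark i)).1 z = if lo <= z <= hi then Some true else None &
      forall z, (T (Work i)).1 z != None -> lo <= z <= hi].

Lemma marked_scan T i lo hi : marked T i lo hi ->
  (ascan (T (Mark i)) != None) = (lo <= (T (Work i)).2 <= hi).
Proof. by case=> <- mE _; rewrite /ascan mE; case: ifP. Qed.

(** The tapes move in parallel, and those already past their marks wait there. Induction on a bound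
    [N] for the longest way left. *)
Lemma seek_path (N : nat) T :
  (forall i, i != ord_max -> exists lo hi, [/\ marked T i lo hi,
     lo <= (T (Work i)).2 <= hi + 1 & hi + 1 - (T (Work i)).2 <= N%:Z]) ->
  exists k T', [/\ path k (Seek, T) (Sweep, T'), T' Count = T Count &
    forall i, i != ord_max ->
      exists lo hi, marked T' i lo hi /\ (T' (Work i)).2 = hi].
Proof.
pose busy T := [exists i, (i != ord_max) && (ascan (T (Mark i)) != None)].
have finish T1 : busy T1 = false ->
  (forall i, i != ord_max -> exists lo hi, marked T1 i lo hi /\
     lo <= (T1 (Work i)).2 <= hi + 1) ->
  exists k T1', [/\ path k (Seek, T1) (Sweep, T1'), T1' Count = T1 Count &
    forall i, i != ord_max ->
      exists lo hi, marked T1' i lo hi /\ (T1' (Work i)).2 = hi].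
  move=> nb TI.
  pose T2 t := if t is Some (_, i) then
      if i != ord_max then ((T1 t).1, (T1 t).2 - 1) else T1 t
    else T1 t.
  exists 1%N, T2; split=> //.
    eexists; last reflexivity; rewrite /astep /= -/(busy T1) nb /=.
    congr pair; apply/funext => -[[c i]|] /=; last by rewrite amove_stay.
    by case: ifP; rewrite ?amove_stay // (amove_scan _ erefl).
  move=> i iM; have [lo [hi [mT pT]]] := TI i iM; exists lo, hi.
  move/negbT: nb; rewrite negb_exists => /forallP/(_ i).
  rewrite iM (marked_scan mT) /= => np.
  rewrite /marked /T2 iM /=; split; last by move: pT np; move: (T1 _).2 => p; lia.
  by case: mT => pE mE wE; rewrite pE.
elim: N T => [|N IH] T TI.
  apply: finish => [|i iM]; last by have [lo [hi [? ? _]]] := TI i iM; exists lo, hi.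
  apply/negbTE; rewrite negb_exists; apply/forallP => i; case: eqP => //= /eqP iM.
  have [lo [hi [mT pT hN]]] := TI i iM; rewrite (marked_scan mT).
  by move: pT hN; move: (T _).2 => p; lia.
case nb: (busy T); last first.
  by apply: finish => // i iM; have [lo [hi [? ? _]]] := TI i iM; exists lo, hi.
pose T1 t := if t is Some (_, i) then
    if (i != ord_max) && (ascan (T (Mark i)) != None)
    then ((T t).1, (T t).2 + 1) else T t
  else T t.
have step1 : astep (Work ord_max) prog phi (Seek, T) (Seek, T1).
  rewrite /astep /= -/(busy T) nb /=; congr pair; apply/funext => -[[c i]|] /=.
    by case: ifP; rewrite ?amove_stay // (amove_scan _ erefl).
  by rewrite amove_stay.
have [i iM|k [T' [p T'C T'I]]] := IH T1; last first.
  by exists k.+1, T'; split=> //; exists (Seek, T1).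
have [lo [hi [mT pT hN]]] := TI i iM; exists lo, hi.
rewrite /marked /T1 iM (marked_scan mT); case: mT => pE mE wE.
case: ifP => inT; (split; first by split=> //=; rewrite ?pE); rewrite /=;
  move: pT hN inT; move: (T _).2 => p; lia.
Qed.

(** Each step shortens every nonempty interval at its right end. Once all are empty, the last clause
    of [marked] says that the work tapes are blank. *)
Lemma sweep_path (N : nat) T :
  (forall i, i != ord_max -> exists lo hi, [/\ marked T i lo hi,
     (T (Work i)).2 = hi & hi + 1 - lo <= N%:Z]) ->
  exists k T', [/\ path k (Sweep, T) (Back, T'), T' Count = T Count &
    forall i, i != ord_max -> [/\ (T' (Mark i)).2 = (T' (Work i)).2,
      blank (T' (Mark i)) & blank (T' (Work i))]].
Proof.
pose busy T := [exists i, (i != ord_max) && (ascan (T (Mark i)) != None)].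
have finish T1 : busy T1 = false ->
  (forall i, i != ord_max -> exists lo hi, marked T1 i lo hi /\
     (T1 (Work i)).2 = hi) ->
  exists k T1', [/\ path k (Sweep, T1) (Back, T1'), T1' Count = T1 Count &
    forall i, i != ord_max -> [/\ (T1' (Mark i)).2 = (T1' (Work i)).2,
      blank (T1' (Mark i)) & blank (T1' (Work i))]].
  move=> nb TI; exists 1%N, T1; split=> //.
    eexists; last reflexivity; rewrite /astep /= -/(busy T1) nb /=.
    by congr pair; apply/funext => t; rewrite amove_stay.
  move=> i iM; have [lo [hi [mT pT]]] := TI i iM.
  move/negbT: nb; rewrite negb_exists => /forallP/(_ i).
  rewrite iM (marked_scan mT) /= pT => np; case: mT => pE mE wE.
  split=> [|z|z]; first by rewrite pE pT.
    by rewrite mE; case: ifP => //; lia.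
  by apply/eqP/negPn/negP => /wE; lia.
elim: N T => [|N IH] T TI.
  apply: finish => [|i iM]; last by have [lo [hi [? ? _]]] := TI i iM; exists lo, hi.
  apply/negbTE; rewrite negb_exists; apply/forallP => i; case: eqP => //= /eqP iM.
  by have [lo [hi [mT ? ?]]] := TI i iM; rewrite (marked_scan mT); lia.
case nb: (busy T); last first.
  by apply: finish => // i iM; have [lo [hi [? ? _]]] := TI i iM; exists lo, hi.
pose T1 t := if t is Some (_, i) then
    if (i != ord_max) && (ascan (T (Mark i)) != None)
    then amove (None, GoLeft) (T t) else T t
  else T t.
have step1 : astep (Work ord_max) prog phi (Sweep, T) (Sweep, T1).
  rewrite /astep /= -/(busy T) nb /=; congr pair; apply/funext => -[[c i]|] /=.
    by case: ifP; rewrite ?amove_stay.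
  by rewrite amove_stay.
have [i iM|k [T' [p T'C T'I]]] := IH T1; last first.
  by exists k.+1, T'; split=> //; exists (Sweep, T1).
have [lo [hi [mT pT hN]]] := TI i iM.
have sE := marked_scan mT; move: sE.
case: (boolP (ascan _ != None)) => mN sE; last first.
  rewrite pT in sE.
  by exists lo, hi; rewrite /marked /T1 (negbTE mN) andbF; split=> //; lia.
exists lo, (hi - 1); rewrite /marked /T1 mN iM /=; case: mT => pE mE wE.
rewrite pE pT; split=> //; last by lia.
split=> // z; case: (eqVneq z hi) => [->|zhi].
- by case: ifP => //; lia.
- by rewrite mE; congr (if _ then _ else _); lia.
- by [].
- by move=> /wE; lia.
Qed.

Lemma uniform_bound (I : finType) (P : I -> nat -> Prop) :
  (forall i k l, (k <= l)%N -> P i k -> P i l) -> (forall i, exists k, P i k) ->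
  exists k, forall i, P i k.
Proof.
move=> Pmono /fin_all_exists[k Pk]; exists (\max_i k i) => i.
by apply: Pmono (Pk i); exact: leq_bigmax.
Qed.

Lemma clean_path c X a : represents c (Stamp, X, a) ->
  exists k d X', [/\ path k c d, represents d (Back, X', a) &
    forall i, i != ord_max -> blank (X' i)].
Proof.
case: c => l T [/= -> TX Ta Tc].
pose T1 t := if t is Some (true, i) then amove (Some true, Stay) (T t) else T t.
have stamp : path 1 (Stamp, T) (Seek, T1).
  eexists; last reflexivity; rewrite /astep /=; congr pair.
  by apply/funext => -[[[] i]|]; rewrite /= /on ?amove_stay.
have [||N TI] := @uniform_bound 'I_n (fun i N => i != ord_max -> exists lo hi,
    [/\ marked T1 i lo hi, lo <= (T1 (Work i)).2 <= hi + 1 &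
        hi + 1 - lo <= N%:Z]).
- move=> i k k' kk' TI /TI[lo [hi [mT ? ?]]]; exists lo, hi; split=> //; lia.
- move=> i; case: (eqVneq i ord_max) => [->|iM]; first by exists 0%N => /eqP.
  have := Tc i iM; rewrite -TX => -[pE [lo [hi [pT mwE]]]].
  exists (absz (hi + 1 - lo)%R) => _; exists lo, hi.
  rewrite /marked /T1 /=; split; try (move: pT; move: (T _).2 => p; lia).
  split=> [|z|z]; first by rewrite addr0.
    rewrite pE; case: (eqVneq z (T (Work i)).2) => [->|/mwE[]//].
    by case: ifP => //; move: pT; move: (T _).2 => p; lia.
  by case: (eqVneq z (T (Work i)).2) => [->|/mwE[_]//].
have [|k1 [T2 [seek T2C T2I]]] := @seek_path N T1.
  move=> i /TI[lo [hi [mT pT hN]]]; exists lo, hi; split=> //.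
  by move: pT hN; move: (T1 _).2 => p; lia.
have [||N' T2N] := @uniform_bound 'I_n (fun i N => i != ord_max -> exists lo hi,
    [/\ marked T2 i lo hi, (T2 (Work i)).2 = hi & hi + 1 - lo <= N%:Z]).
- by move=> i k k' kk' TI' /TI'[lo [hi [mT ? ?]]]; exists lo, hi; split=> //; lia.
- move=> i; case: (eqVneq i ord_max) => [->|iM]; first by exists 0%N => /eqP.
  have [lo [hi [mT pT]]] := T2I i iM.
  by exists (absz (hi + 1 - lo)%R) => _; exists lo, hi; split=> //; lia.
have [k2 [T3 [sweep T3C T3I]]] := @sweep_path N' T2 T2N.
exists (1 + (k1 + k2))%N, (Back, T3), (fun i => T3 (Work i)); split.
- exact: apath_cat stamp (apath_cat seek sweep).
- split=> //=; first by rewrite T3C T2C -Ta.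
  (* The interval consists of the scanned cell alone, which is exempt, so a blank mark tape is
     adequate. *)
  move=> i /T3I[pE M0 W0]; split=> //; exists (T3 (Work i)).2, (T3 (Work i)).2.
  rewrite lexx; split=> // z zp; rewrite M0 W0; split=> //.
  by have -> : ((T3 (Work i)).2 <= z <= (T3 (Work i)).2) = false by lia.
- by move=> i /T3I[].
Qed.

End Clean.


(** * Incrementing the counter and chaining the trials *)

Lemma counter_scan s l :
  ascan (counter (s ++ l), -1 - (size s)%:Z) = nth None (map Some l) 0.
Proof.
have -> : -1 - Posz (size s) = Negz (size s) by lia.
by rewrite /ascan /= map_cat nth_cat size_map ltnn subnn.
Qed.

Lemma counter_write s l b d :
  amove (Some b, d) (counter (s ++ l), -1 - (size s)%:Z) =
  (counter (s ++ b :: behead l), -1 - (size s)%:Z + displacement d).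
Proof.
congr pair; apply/funext => -[k|k] /=; first by case: eqP => //; lia.
have -> : (Negz k == -1 - Posz (size s)) = (k == size s) by lia.
rewrite !map_cat !nth_cat size_map; case: (ltngtP k (size s)) => [//|lt|->].
  by rewrite -(subnKC lt) addSnnS addKn; case: (l) => //=; rewrite nth_nil.
by rewrite subnn.
Qed.

(** The prefix [nseq i false] holds the letters that the carry has already passed. *)
Lemma carry_leads X i l :
  leads (Carry, X, (counter (nseq i false ++ l), -1 - i%:Z))
    (Blank Reset, X, (counter (nseq i false ++ inc l), 0)).
Proof.
have stop i' l' : leads (Turn Next, X, (counter (nseq i' false ++ l'), -1 - i'%:Z))
    (Blank Reset, X, (counter (nseq i' false ++ l'), 0)).
  by apply: turn_leads; rewrite size_cat size_nseq leq_addr.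
elim: l i => [|b l IH] i; (eapply lead; [reflexivity|]);
  have sc := counter_scan (nseq i false); have wr := counter_write (nseq i false);
  rewrite size_nseq in sc wr; rewrite /after_act sc.
- rewrite /= amove_on upd_None wr addr0; exact: stop.
- case: b => /=; rewrite amove_on upd_None wr /= ?addr0; last exact: stop.
  have catE l' : nseq i false ++ false :: l' = nseq i.+1 false ++ l'.
    by elim: (i) => //= i' ->.
  by have := IH i.+1; rewrite !catE; have -> : -1 - Posz i - 1 = -1 - i.+1%:Z by lia.
Qed.

Lemma increment_leads X r :
  leads (Back, X, (counter r, 0)) (Blank Reset, X, (counter (inc r), 0)).
Proof.
eapply lead; first reflexivity.
rewrite /after_act /= amove_on upd_None (amove_scan _ erefl) /= sub0r.
by have := @carry_leads X 0 r; rewrite subr0.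
Qed.

Lemma trial_ends r v X : (forall i, i != ord_max -> blank (X i)) ->
  outputs K (answers r) (rev (copied Padded r)) v ->
  exists2 X', leads (Blank Reset, X, (counter r, 0)) (Blank Load, X', (counter r, 0)) &
    test_ends r (Blank Load, X', (counter r, 0)) (accepts r v).
Proof.
move=> /(reset_leads r)[X1 reset X1_blank] [t [halt_t out_t]]; exists X1 => //.
have [X2 load X2K] := load_leads r X1_blank.
have [X3 run X3K] := @run_leads r (init K _) X2 t X2K.
apply: test_ends_trans load _; apply: test_ends_trans run _.
by apply: run_ends => //; rewrite -out_t; exact: models_word.
Qed.

Lemma accepting_trial r v X : (forall i, i != ord_max -> blank (X i)) ->
  outputs K (answers r) (rev (copied Padded r)) v -> accepts r v ->
  exists X' a, leads (Blank Reset, X, (counter r, 0)) (Success, X', a).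
Proof.
move=> X0 /(trial_ends X0)[X1 reset] + rv; rewrite rv => -[X2 [a test]].
by exists X2, a; exact: leads_trans reset test.
Qed.

(** The length [k.+1] is positive, so that endless rejection yields arbitrarily long paths. *)
Lemma rejecting_trial r v X c : (forall i, i != ord_max -> blank (X i)) ->
  outputs K (answers r) (rev (copied Padded r)) v -> ~~ accepts r v ->
  represents c (Blank Reset, X, (counter r, 0)) ->
  exists k d X', [/\ path k.+1 c d, represents d (Blank Reset, X', (counter (inc r), 0)) &
    forall i, i != ord_max -> blank (X' i)].
Proof.
move=> X0 /(trial_ends X0)[X1 reset] + /negbTE rv; rewrite rv => -[X2 [k kr test]] cX.
(* The reset takes at least one step because it changes the label. *)
have [[|k1] [c1 [p1 c1X]]] := reset _ cX.
  by case: cX c1X => cE _ _ _ [+ _ _ _]; rewrite -p1 cE.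
have [k2 [c2 [p2 /(turn_leads kr)[k3 [c3 [p3 c3X]]]]]] := test _ c1X.
have [k4 [c4 [X4 [p4 c4X X4_blank]]]] := clean_path c3X.
have [k5 [c5 [p5 c5X]]] := increment_leads c4X.
exists (k1 + (k2 + (k3 + (k4 + k5))))%N, c5, X4; split=> //.
rewrite -addSn; do 3![apply: apath_cat; [eassumption|]]; exact: apath_cat p4 p5.
Qed.

End Leads.

Theorem search_machine : exists M : oracle_machine,
  forall (phi : bitstring -> bitstring) (V : bitstring -> bitstring),
  (forall r, outputs K (answers phi r) (rev (copied Padded r)) (V r)) ->
  halts M phi [::] <-> exists r, accepts r (V r).
Proof.
have cardN : (1 < #|{: tape_name}|)%N.
  by rewrite card_option card_prod card_bool card_ord.
have [M MP] := concrete_machine (Work ord_max) (Blank Reset) prog cardN.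
exists M => phi V VP; have [M_halts M_loops] := MP phi.
have start_represents :
    represents (Blank Reset, fun=> ablank) (Blank Reset, fun=> ablank, (counter [::], 0)).
  split=> //= [|i _].
    by congr pair; apply/funext => -[] k //=; rewrite nth_nil.
  split=> //; exists 0, 0; split=> // z /= z0; split=> //.
  by have -> : (0 <= z <= 0) = false by lia.
(* Invariant of the search: after [m] rejections, and at least [m] steps, trial number [m] starts on
   clean tapes. *)
have reach m : (forall k, (k < m)%N -> ~~ accepts (iter k inc [::]) (V (iter k inc [::]))) ->
    exists l c X, [/\ (m <= l)%N,
      apath (Work ord_max) prog phi l (Blank Reset, fun=> ablank) c,
      represents c (Blank Reset, X, (counter (iter m inc [::]), 0)) &
      forall i, i != ord_max -> blank (X i)].
  elim: m => [|m IH] rej.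
    by exists 0%N, (Blank Reset, fun=> ablank), (fun=> ablank).
  have [|l [c [X [ml p cX X0]]]] := IH; first by move=> k /ltnW; exact: rej.
  have [k [d [Y [q dY Y0]]]] := rejecting_trial X0 (VP _) (rej m (ltnSn m)) cX.
  exists (l + k.+1)%N, d, Y; split=> //; last exact: apath_cat p q.
  by rewrite addnS ltnS (leq_trans ml) ?leq_addr.
split=> [|[r0 r0P]].
  apply: contraPP => no; apply: M_loops => m.
  have [|l [c [X [ml p _ _]]]] := reach m; last by exists l, c.
  by move=> k _; apply/negP => rP; apply: no; eexists; exact: rP.
have [m0 m0E] := iter_inc r0.
have ex : exists m, accepts (iter m inc [::]) (V (iter m inc [::])) by exists m0; rewrite m0E.
(* All trials before the least accepted one are rejected, so the machine gets to it. *)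
case: (ex_minnP ex) => m mP m_min.
have [|l [c [X [_ p cX X0]]]] := reach m.
  by move=> k; apply: contraL => /m_min; rewrite -leqNgt.
have [X' [a /(_ _ cX)[k [d [q [dE _ _ _]]]]]] := accepting_trial X0 (VP _) mP.
by apply: (M_halts (l + k)%N d); [exact: apath_cat p q|rewrite dE].
Qed.

End Machine.

(** * The accepting condition as an inequality *)

(** The exponent j of the trial w 1 0^j: in the reversed string its zeros come first. *)
Definition trailing (r : bitstring) : nat := find id r.

Lemma nat_of_str_cons b v :
  nat_of_str (b :: v) = (b.+1 * 2 ^ size v + nat_of_str v)%N.
Proof.
elim/last_ind: v => [|v c IH]; first by rewrite /nat_of_str /= muln1; case: b.
rewrite -rcons_cons !nat_of_str_rcons IH size_rcons expnS; case: c; lia.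
Qed.

Lemma nat_of_str_ge v : (2 ^ size v <= (nat_of_str v).+1)%N.
Proof. by elim: v => // b v IH; rewrite nat_of_str_cons /= expnS; lia. Qed.

Lemma nat_of_str_lt v : (nat_of_str v + 2 <= 2 ^ (size v).+1)%N.
Proof.
elim: v => // b v IH; rewrite nat_of_str_cons /= !expnS in IH *; case: b; lia.
Qed.

(** A further zero sends n to 2n + 1, hence doubles n + 1. *)
Lemma nat_of_str_zeros w s :
  ((nat_of_str (w ++ nseq s false)).+1 = (nat_of_str w).+1 * 2 ^ s)%N.
Proof.
elim: s => [|s IH]; first by rewrite cats0 muln1.
rewrite -[s.+1]addn1 nseqD catA cats1 nat_of_str_rcons expnD mulnA -IH; lia.
Qed.

Lemma pass_true r v : pass true r v = ((trailing r).+2 <= size v)%N.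
Proof. by elim: r v => [|[] r IH] [|b [|c [|d v]]] //=; rewrite IH. Qed.

(** With t = [trailing r], the bound is the value of 0^(t-1) 1 0 0, or of 0 0 0 if t = 0. In
    length-lexicographic order, the strings from there on are those longer than t + 2 and those of
    length t + 2 with a 1 among the first t letters. *)
Lemma pass_false r v :
  pass false r v = (2 ^ (trailing r).+2 + 3 <= nat_of_str v)%N.
Proof.
have base u : pass false [::] u = (2 ^ 2 + 3 <= nat_of_str u)%N.
  case: u => [|b [|c [|d u]]] //=; rewrite !nat_of_str_cons /= ?expnS.
  - by case: b.
  - by case: b; case: c.
  - by have := expn_gt0 2 (size u); lia.
elim: r v => [|[] r IH] v; rewrite ?base //; first by rewrite -[RHS]base; case: v.
case: v => [|[] v]; first by rewrite /= addn3.
  rewrite /= pass_true nat_of_str_cons; have := nat_of_str_ge v; have := nat_of_str_lt v.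
  rewrite -/(trailing r) !expnS.
  case: (leqP (trailing r).+2 (size v)) => h.
    by have := leq_pexp2l (isT : (0 < 2)%N) h; rewrite !expnS; have := expn_gt0 2 (trailing r); lia.
  by have := leq_pexp2l (isT : (0 < 2)%N) h; rewrite !expnS; lia.
rewrite /= IH nat_of_str_cons; have := nat_of_str_ge v; have := nat_of_str_lt v.
rewrite -/(trailing r) !expnS.
case: (ltngtP (trailing r).+2 (size v)) => h.
- by have := leq_pexp2l (isT : (0 < 2)%N) h; rewrite !expnS; have := expn_gt0 2 (trailing r); lia.
- by have := leq_pexp2l (isT : (0 < 2)%N) h; rewrite !expnS; lia.
- by rewrite -h !expnS; lia.
Qed.

Lemma copied_padded r :
  rev (copied Padded r) = rev (copied Plain r) ++ nseq (trailing r).+2 false.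
Proof.
have cutE u : rev (cut Padded u) = rev (cut Plain u) ++ nseq (trailing u) false.
  elim: u => [|[] u IH] //=; first by rewrite cats0.
  by rewrite rev_cons IH -cats1 -catA -[[:: false]]/(nseq 1 false) -nseqD addn1.
rewrite /copied rev_cat cutE -catA -[rev [:: false; false]]/(nseq 2 false) -nseqD.
by rewrite addn2.
Qed.

Lemma copied_flat r : copied Flat r = nseq (size r).+2 false.
Proof. by rewrite /copied /=; do 2!congr cons; elim: r => [|[] r IH] //=; rewrite IH. Qed.

Lemma copied_size r : (size (copied Padded r) <= (size r).+2)%N.
Proof. by rewrite /copied /= !ltnS; elim: r => [|[] r IH] //=; lia. Qed.

(** * Names and consistency *)

Definition tolerance (R : realType) (w : bitstring) : R := (nat_of_str w).+1%:R^-1.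

Section Metric.
Variables (R : realType) (M : metricType R) (r : nat -> M).

Local Notation tolerance := (@tolerance R).

Definition consistent (phi : bitstring -> bitstring) : Prop := forall v w,
  mdist (r (nat_of_str (phi v))) (r (nat_of_str (phi w))) <= tolerance v + tolerance w.

Lemma dom_consistent phi : dom (cauchy_rep r) phi -> consistent phi.
Proof.
case=> x xP v w; apply: le_trans (metric_triangle _ x _) _.
by rewrite metric_sym lerD ?xP.
Qed.

Lemma tolerance_zeros t : tolerance (nseq t false) = (2 ^ t)%:R^-1.
Proof. by rewrite /tolerance -[nseq t false]cat0s nat_of_str_zeros mul1n. Qed.

Lemma near_tolerance_le (e : R) : 0 < e ->
  \forall t \near \oo, tolerance (nseq t false) <= e.
Proof.
move=> e0; near=> t; apply: le_trans (_ : t.+1%:R^-1 <= e).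
  by rewrite tolerance_zeros lef_pV2 ?posrE ?ltr0n ?expn_gt0 // ler_nat ltn_expl.
by apply: ltW; near: t; exact: (near_infty_natSinv_lt (PosNum e0)).
Unshelve. all: by end_near. Qed.

(** The error [e] makes room for rejected trials, which bound distances only up to a term vanishing
    along 0^t. The named point is the limit of the points with indices phi(0^t). *)
Lemma dom_of_near (phi : baire) : complete_metric M ->
  (forall w (e : R), 0 < e -> \forall t \near \oo,
     mdist (r (nat_of_str (phi w))) (r (nat_of_str (phi (nseq t false)))) <= tolerance w + e) ->
  dom (cauchy_rep r) phi.
Proof.
move=> Mcomplete near_phi; pose a t := r (nat_of_str (phi (nseq t false))).
have /Mcomplete[x ax] : cauchy (a @ \oo).
  (* The tolerance at 0^N and the error each take e / 4, leaving the strict inequality that the ball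
     demands. *)
  apply/cauchy_exP => e e0; have e4 : 0 < e / 4 by rewrite divr_gt0.
  have [N _ NP] := near_tolerance_le e4.
  have Ne : tolerance (nseq N false) <= e / 4 by apply: NP => /=.
  exists (a N); near=> t; rewrite ballEmdist /=.
  apply: (@le_lt_trans _ _ (tolerance (nseq N false) + e / 4)); last by lra.
  by near: t; exact: near_phi.
exists x => w; rewrite -/(tolerance w); apply/ler_addgt0Pr => e e0.
have e2 : 0 < e / 2 by rewrite divr_gt0.
near \oo => t.
have xa : mdist x (a t) <= e / 2 by near: t; exact: (metricType_numDomainType.cvgr_dist_le ax).
have aw : mdist (r (nat_of_str (phi w))) (a t) <= tolerance w + e / 2.
  by near: t; exact: near_phi.
have := metric_triangle x (a t) (r (nat_of_str (phi w))).
by rewrite [mdist (a t) _]metric_sym; lra.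
Unshelve. all: by end_near. Qed.

Lemma consistent_dom (phi : baire) :
  complete_metric M -> consistent phi -> dom (cauchy_rep r) phi.
Proof.
move=> Mcomplete phiP; apply: dom_of_near => // w e e0; near=> t.
apply: le_trans (phiP _ _) _; rewrite lerD2l; near: t; exact: near_tolerance_le.
Unshelve. all: by end_near. Qed.

(** * Completeness and closedness of the domain *)

Lemma near_evaluation (phi : baire) w : \forall psi \near phi, psi w = phi w.
Proof.
have w_cont := @proj_continuous (seq bool) (fun=> discrete_topology bitstring) w phi.
exact: (w_cont [set phi w] (discrete_set1 (phi w : discrete_topology bitstring))).
Qed.

Lemma cvg_evaluation (psi : nat -> baire) (phi : baire) :
  (forall w, \forall k \near \oo, psi k w = phi w) -> psi @ \oo --> phi.
Proof.
move=> psi_phi; apply/cvg_sup => w; apply/cvg_image.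
  by rewrite eqEsubset; split=> v // _; exists (fun=> v).
apply: cvg_trans (_ : (fun k => psi k w) @ \oo --> phi w); last first.
  by apply/discrete_cvg; exact: psi_phi.
move=> A /= A_oo; exists [set chi | A (chi w)] => //.
by rewrite eqEsubset; split=> [v [chi ? <-] //|v Av]; exists (fun=> v).
Qed.

(** Each inequality of consistency involves two values of [phi], and some name in the domain shares
    both. *)
Lemma closed_dom : complete_metric M -> closed (dom (cauchy_rep r)).
Proof.
move=> Mcomplete phi phi_cl; apply: consistent_dom => // v w.
have [psi [/dom_consistent psiP [<- <-]]] : dom (cauchy_rep r) `&`
    ([set psi | psi v = phi v] `&` [set psi | psi w = phi w]) !=set0.
  by apply: phi_cl; apply: filterI; exact: near_evaluation.
exact: psiP.
Qed.

Hypothesis r_dense : dense (range r).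

Lemma dense_index (x : M) (e : R) : 0 < e ->
  exists w, mdist x (r (nat_of_str w)) < e.
Proof.
move=> e0; have : nbhs x (ball x e) by exact: nbhsx_ballx.
rewrite nbhsE => -[U [U_open Ux] U_ball].
have [|y [/U_ball xy [i _ iE]]] := r_dense _ U_open; first by exists x.
have [g _ gK] := nat_of_str_bij; exists (g i).
by rewrite gK iE; move: xy; rewrite ballEmdist.
Qed.

Lemma exists_name (x : M) : exists phi : baire, cauchy_rep r phi x.
Proof.
have /choice[phi phiP] : forall w, exists v, mdist x (r (nat_of_str v)) <= tolerance w.
  move=> w; have [|v /ltW] := @dense_index x (tolerance w); last by exists v.
  by rewrite /tolerance invr_gt0.
by exists phi.
Qed.

Lemma complete_of_closed : closed (dom (cauchy_rep r)) -> complete_metric M.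
Proof.
move=> dom_closed u /cauchyP u_cauchy.
(* [phi] is the prospective name of the limit: its value at [w] is accurate for almost all terms of
   [u]. *)
have /choice[phi phiP] : forall w, exists v,
    \forall k \near \oo, mdist (u k) (r (nat_of_str v)) <= tolerance w.
  move=> w; have w2 : 0 < tolerance w / 2 by rewrite divr_gt0 ?invr_gt0 /tolerance ?invr_gt0.
  have [x] := u_cauchy _ w2; rewrite ballEmdist => xu.
  have [v xv] := dense_index x w2; exists v; near=> k.
  have ux : mdist x (u k) < tolerance w / 2.
    by near: k; exact: xu.
  apply: le_trans (metric_triangle _ x _) _; rewrite metric_sym; lra.
have /choice[name nameP] k := exists_name (u k).
(* Following [phi] only where it is accurate for [u k], and a fixed name elsewhere, keeps [psi k] a
   name of [u k]; at each [w] it eventually agrees with [phi]. *)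
pose psi k : baire := fun w =>
  if mdist (u k) (r (nat_of_str (phi w))) <= tolerance w then phi w else name k w.
have psi_dom : \forall k \near \oo, dom (cauchy_rep r) (psi k).
  by apply: nearW => k; exists (u k) => w; rewrite /psi; case: ifP => // _; exact: nameP.
have psi_cvg : psi @ \oo --> (phi : baire).
  apply: cvg_evaluation => w.
  by apply: filterS (phiP w) => k kw; rewrite /psi kw.
have [x xP] : dom (cauchy_rep r) phi := closed_cvg _ dom_closed psi_dom _ psi_cvg.
exists x; apply/metricType_numDomainType.cvgrPdist_lt => e e0.
have e4 : 0 < e / 4 by rewrite divr_gt0.
have [N _ NP] := near_tolerance_le e4.
have Ne : tolerance (nseq N false) <= e / 4 by apply: NP => /=.
near=> k.
have uk : mdist (u k) (r (nat_of_str (phi (nseq N false)))) <= tolerance (nseq N false).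
  by near: k; exact: phiP.
have xr : mdist x (r (nat_of_str (phi (nseq N false)))) <= tolerance (nseq N false) := xP _.
have := metric_triangle x (r (nat_of_str (phi (nseq N false)))) (u k).
by rewrite [mdist (r _) (u k)]metric_sym; lra.
Unshelve. all: by end_near. Qed.

End Metric.

Lemma accepts_int u v z : int_of_str v = Some z ->
  accepts u v = ((2 ^ (trailing u).+2 + 3)%N%:Z <= z).
Proof. by case: v => [|[] v] // [<-] //=; rewrite pass_false lez_nat. Qed.

(** * Soundness and completeness of the search *)

Section Search.
Variables (R : realType) (M : metricType R) (r : nat -> M).
Local Notation tolerance := (@tolerance R).
Local Notation value phi w := (r (nat_of_str (phi w))).

(** What [real_rep] demands of the answer [z] on the padded input. *)
Definition approximates (phi : bitstring -> bitstring) (u : bitstring) (z : int) :=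
  `|mdist (value phi (rev (copied Plain u))) (value phi (rev (copied Flat u)))
    - z%:~R * tolerance (rev (copied Padded u))| <= tolerance (rev (copied Padded u)).

Lemma tolerance_gt0 w : 0 < tolerance w.
Proof. by rewrite invr_gt0. Qed.

Lemma tolerance_padded u : tolerance (rev (copied Plain u)) =
  (2 ^ (trailing u).+2)%:R * tolerance (rev (copied Padded u)).
Proof.
rewrite copied_padded /tolerance nat_of_str_zeros natrM invfM mulrC mulfVK //.
Qed.

(** The padded string, of value k, has at most |u| + 2 letters, so k + 2 <= 2^(|u|+3), twice the
    reciprocal of the left side. *)
Lemma tolerance_flat u : tolerance (rev (copied Flat u)) < 2 * tolerance (rev (copied Padded u)).
Proof.
rewrite copied_flat rev_nseq tolerance_zeros -ltf_pV2 ?posrE ?mulr_gt0 ?tolerance_gt0 //.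
rewrite invfM !invrK ltr_pdivrMl // -natrM ltr_nat -expnS.
have := nat_of_str_lt (rev (copied Padded u)).
by have := leq_pexp2l (isT : (0 < 2)%N) (copied_size u); rewrite size_rev !expnS; lia.
Qed.

(** In units of the padded tolerance, with t = [trailing u], the distance is at least 2^(t+2) + 3 -
    1, while consistency allows less than 2^(t+2) + 2. *)
Lemma accepted_inconsistent phi u (z : int) : approximates phi u z ->
  (2 ^ (trailing u).+2 + 3)%N%:Z <= z -> ~ consistent r phi.
Proof.
move=> /ler_normlP[+ _] zP cons; have := cons (rev (copied Plain u)) (rev (copied Flat u)).
have := tolerance_flat u; rewrite -!/(tolerance _) tolerance_padded.
have : ((2 ^ (trailing u).+2)%:R + 3) * tolerance (rev (copied Padded u)) <=
    z%:~R * tolerance (rev (copied Padded u)).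
  by rewrite ler_pM2r ?tolerance_gt0 //; move: zP; rewrite -(ler_int R) -pmulrn natrD.
rewrite mulrDl; lra.
Qed.

(** Since [z] is an integer, it is at most 2^(t+2) + 2 with t = [trailing u]; the approximation
    error raises the 2 to the 3 of the bound. *)
Lemma rejected_near phi u (z : int) : approximates phi u z ->
  ~~ ((2 ^ (trailing u).+2 + 3)%N%:Z <= z) ->
  mdist (value phi (rev (copied Plain u))) (value phi (rev (copied Flat u))) <=
  tolerance (rev (copied Plain u)) + 3 * tolerance (nseq (trailing u).+2 false).
Proof.
move=> /ler_normlP[_ +] zP.
have : z%:~R * tolerance (rev (copied Padded u)) <=
    ((2 ^ (trailing u).+2)%:R + 2) * tolerance (rev (copied Padded u)).
  rewrite ler_pM2r ?tolerance_gt0 //.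
  have : z <= (2 ^ (trailing u).+2 + 2)%N%:Z by lia.
  by rewrite -(ler_int R) -pmulrn natrD.
rewrite mulrDl -tolerance_padded.
have : tolerance (rev (copied Padded u)) <= tolerance (nseq (trailing u).+2 false).
  rewrite tolerance_zeros copied_padded /tolerance nat_of_str_zeros.
  have s_gt0 : (0 < 2 ^ (trailing u).+2)%N by rewrite expn_gt0.
  rewrite lef_pV2 ?ler_nat ?leq_pmull // posrE ltr0n //.
  exact: leq_trans s_gt0 (leq_pmull _ _).
lra.
Qed.

Lemma rejected_dom (phi : baire) : complete_metric M ->
  (forall u, exists2 z, approximates phi u z &
     ~~ ((2 ^ (trailing u).+2 + 3)%N%:Z <= z)) ->
  dom (cauchy_rep r) phi.
Proof.
move=> Mcomplete rej; apply: dom_of_near => // w e e0.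
have e3 : 0 < e / 3 by rewrite divr_gt0.
have [N _ NP] := near_tolerance_le e3; exists (N + size w + 3)%N => // t /= tN.
(* The trial w 1 0^j, reversed, with j such that its length plus two is t; then [Flat] yields
   0^t. *)
pose j := (t - size w - 3)%N; pose u := nseq j false ++ true :: rev w.
have [z /rejected_near/[apply]] := rej u.
have trE : trailing u = j.
  by rewrite /trailing find_cat has_nseq andbF /= size_nseq addn0.
have plainE : copied Plain u = rev w.
  by rewrite /copied /u /=; elim: (j).
have flatE : copied Flat u = nseq t false.
  rewrite copied_flat; suff -> : (size u).+2 = t by [].
  by rewrite size_cat size_nseq /= size_rev; lia.
rewrite trE plainE flatE revK rev_nseq => /le_trans; apply.
rewrite lerD2l; have : tolerance (nseq j.+2 false) <= e / 3 by apply: NP => /=; lia.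
lra.
Qed.

Lemma computably_complete : complete_metric M -> computable_metric r ->
  computably_complete_rep (cauchy_rep r).
Proof.
move=> Mcomplete [K KP]; have [S SP] := search_machine K; exists S => phi.
have /choice[V VP] : forall u, exists v,
    outputs K (answers phi u) (rev (copied Padded u)) v /\
    exists2 z, int_of_str v = Some z & approximates phi u z.
  move=> u; set i := rev (copied Plain u); set j := rev (copied Flat u).
  (* Constant functions name natural numbers, so this oracle is a name of a pair for every [phi], in
     the domain or not, and [K] halts. *)
  have [|psi [psiK psiR]] := KP (answers phi u) (nat_of_str (phi i), nat_of_str (phi j)).
    by exists (fun=> phi i), (fun=> phi j); split=> // w.
  exists (psi (rev (copied Padded u))); split; first exact: psiK.
  exact: psiR.
rewrite (SP phi V (fun u => (VP u).1)); split=> [[u]|ndom].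
  have [_ [z vz uz]] := VP u; rewrite (accepts_int _ vz).
  by move=> /(accepted_inconsistent uz) + /dom_consistent.
apply: contrapT => no; apply: ndom; apply: rejected_dom => // u.
have [_ [z vz uz]] := VP u; exists z => //.
by rewrite -(accepts_int _ vz); apply/negP => uV; apply: no; exists u.
Qed.

End Search.

Theorem mainTheorem5 (R : realType) (M : metricType R) (r : nat -> M)
    (r_dense : dense (range r)) :
  (complete_rep (cauchy_rep r) <-> complete_metric M) /\
  (complete_metric M -> computable_metric r ->
     computably_complete_rep (cauchy_rep r)).
Proof.
split; last exact: computably_complete.
by split; [exact: complete_of_closed|exact: closed_dom].
Qed.
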